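(* Let $U$ be a Milliken-Taylor ultrafilter on $\mathrm{FIN}$. Then $(U\cdot U,\supseteq)\equiv_T(U,\supseteq)$.
   Context: $\mathrm{FIN}=[\omega]^{<\omega}\setminus\{\emptyset\}$. A block sequence is a sequence $\langle x_i:i<n\rangle$ ($n\le\omega$) of elements of $\mathrm{FIN}$ with $\max(x_i)<\min(x_j)$ whenever $i<j$; $\mathrm{FIN}^{[\infty]}$ is the set of infinite block sequences. For $X=\langle x_i:i<\omega\rangle\in\mathrm{FIN}^{[\infty]}$, $[X]=\{\bigcup_{i\in F}x_i:F\in\mathrm{FIN}\}$; $X/m=\langle x_i:i\ge n\rangle$ where $n$ is least with $\min(x_n)>m$; $Y\le^*X$ iff there is $m$ with $[Y/m]\subseteq[X]$. An ultrafilter $U$ on $\mathrm{FIN}$ is Milliken-Taylor iff (1) for every $A\in U$ there is $X\in\mathrm{FIN}^{[\infty]}$ with $[X]\subseteq A$ and $[X]\in U$; and (2) whenever $X_0\ge^*X_1\ge^*\cdots$ are in $\mathrm{FIN}^{[\infty]}$ with each $[X_n]\in U$, there is $Y\in\mathrm{FIN}^{[\infty]}$ with $[Y]\in U$ and $X_n\ge^*Y$ for all $n$. For filters $U$ on $X$ and $V$ on $Y$, $U\cdot V$ is the filter on $X\times Y$ with $A\in U\cdot V$ iff $\{x:\{y:(x,y)\in A\}\in V\}\in U$. $P\le_T Q$ means there is $f:Q\to P$ sending cofinal subsets of $Q$ to cofinal subsets of $P$; $\equiv_T$ means both $\le_T$ directions. Filters are ordered by $\supseteq$. *)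

(* Defs.v *)
From HB Require Import structures.
From mathcomp Require Import all_boot all_order finmap.
From mathcomp Require Import mathcomp_extra boolp classical_sets functions filter.

Set Implicit Arguments.
Unset Strict Implicit.
Unset Printing Implicit Defensive.

Local Open Scope classical_set_scope.

Definition FIN : Type := {x : {fset nat} | x != fset0}.

Definition FINmax (x : FIN) : nat := \max_(a <- enum_fset (val x)) a.

(* The default value [FINmax x] of the iterated minimum is harmless since [x]
   is nonempty. *)
Definition FINmin (x : FIN) : nat :=
  \big[minn/FINmax x]_(a <- enum_fset (val x)) a.

Lemma FINmax_ge (x : FIN) (a : nat) : a \in val x -> a <= FINmax x.
Proof. by move=> ax; apply: (@leq_bigmax_seq _ _ xpredT id). Qed.

Lemma FINmin_le (x : FIN) (a : nat) : a \in val x -> FINmin x <= a.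
Proof.
rewrite /FINmin; change (a \in val x) with (a \in enum_fset (val x)).
elim: (enum_fset (val x)) => // b s IHs.
rewrite big_cons inE => /orP[/eqP ->|/IHs le_sa]; first exact: geq_minl.
exact: leq_trans (geq_minr _ _) le_sa.
Qed.

Lemma FINmax_in (x : FIN) : FINmax x \in val x.
Proof.
case: x => x x0; rewrite /FINmax /=.
have [a ax] := fset0Pn _ x0.
have : (\max_(a <- enum_fset x) a \in enum_fset x)
     || (nilp (enum_fset x)).
  elim: (enum_fset x) => // b s /orP[sP|/nilP ->].
    by rewrite big_cons inE; case: leqP => _; rewrite ?eqxx ?sP ?orbT.
  by rewrite big_cons big_nil maxn0 inE eqxx.
by case/orP => // /nilP s0; move: ax; rewrite -[a \in _]/(a \in enum_fset x) s0.
Qed.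

Lemma FINmin_in (x : FIN) : FINmin x \in val x.
Proof.
rewrite /FINmin big_seq; apply: (big_ind (fun m => m \in val x)) => //.
- exact: FINmax_in.
- by move=> a b; case: leqP.
Qed.

Lemma FINmin_le_max (x : FIN) : FINmin x <= FINmax x.
Proof. exact: FINmin_le (FINmax_in x). Qed.

Record FINinf : Type := BlockSeq {
  block :> nat -> FIN;
  blockP : forall i j, i < j -> FINmax (block i) < FINmin (block j) }.

Definition block_span (X : FINinf) : set FIN :=
  [set y : FIN | exists F : FIN,
    val y = \big[fsetU/fset0]_(i <- enum_fset (val F)) val (X i)].

Lemma block_min_ge (X : FINinf) (n : nat) : n <= FINmin (X n).
Proof.
elim: n => // n IHn; apply: leq_ltn_trans (blockP X (ltnSn n)).
exact: leq_trans IHn (FINmin_le_max _).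
Qed.

Lemma ex_min_gt (X : FINinf) (m : nat) : exists n, m < FINmin (X n).
Proof. by exists m.+1; apply: block_min_ge. Qed.

(* X/m *)
Definition block_tail (X : FINinf) (m : nat) : FINinf :=
  let n := ex_minn (ex_min_gt X m) in
  @BlockSeq (fun i => X (n + i))
    (fun i j (ij : i < j) =>
       blockP X (etrans (ltn_add2l n i j) ij)).

(* Y <=* X *)
Definition almost_le (Y X : FINinf) : Prop :=
  exists m, block_span (block_tail Y m) `<=` block_span X.

Definition milliken_taylor (U : set_system FIN) : Prop :=
  [/\ UltraFilter U,
      forall A, U A -> exists X : FINinf, block_span X `<=` A /\ U (block_span X)
    & forall X : nat -> FINinf,
        (forall n, almost_le (X n.+1) (X n)) ->
        (forall n, U (block_span (X n))) ->
        exists Y : FINinf, U (block_span Y) /\ forall n, almost_le Y (X n)].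

Definition fubini_prod (X Y : Type) (U : set_system X) (V : set_system Y) :
    set_system (X * Y) :=
  [set A | U [set x | V [set y | A (x, y)]]].

Lemma fubini_prod_filter (X Y : Type) (U : set_system X) (V : set_system Y) :
  Filter U -> Filter V -> Filter (fubini_prod U V).
Proof.
move=> fU fV; split; rewrite /fubini_prod /=.
- rewrite (_ : [set x | _] = setT); first exact: filterT.
  by apply/seteqP; split => // x _; exact: filterT.
- move=> A B /= UA UB; apply: (@filterS2 _ U fU _ _ _ _ UA UB) => x /=.
  exact: (@filterI _ V fV).
- move=> A B AB /=; apply: (@filterS _ U fU) => x /=.
  by apply: (@filterS _ V fV) => y; exact: AB.
Qed.

Definition cofinal (P : Type) (le : P -> P -> Prop) (D : set P) : Prop :=
  forall p, exists2 d, D d & le p d.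

Definition tukey_le (P Q : Type) (leP : P -> P -> Prop)
    (leQ : Q -> Q -> Prop) : Prop :=
  exists f : Q -> P, forall D : set Q, cofinal leQ D -> cofinal leP (f @` D).

Definition tukey_equiv (P Q : Type) (leP : P -> P -> Prop)
    (leQ : Q -> Q -> Prop) : Prop :=
  tukey_le leP leQ /\ tukey_le leQ leP.

(* Members of a filter ordered by reverse inclusion, so that smaller sets are
   further up. *)
Definition rev_incl (T : Type) (U : set_system T) : U -> U -> Prop :=
  fun A B => val B `<=` val A.
Arguments rev_incl {T} U.

(* Main.v *)
(** The map sending [B] in [U] to the set of pairs [(x, y)] of elements of [B]
    with [max x < min y] is monotone into [U . U]; it is cofinal as soon as
    every [A] in [U . U] contains all such pairs for some [B] in [U].  Stability
    gives a span [[Y]] in [U] and a function [g] such that [(x, y)] is in [A]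
    whenever [y] is in [[Y]], the section of [A] at [x] is in [U] and
    [min y > g (max x)].  To make all gaps that large, colour [x] by the
    parity of the number of [a] in [x] whose successor in [x], if any, exceeds
    [g a].  These numbers add up for [x] and [y], except that the union
    loses one when [min y <= g (max x)].  On a homogeneous span the gaps
    are thus all large or all small, and the latter
    is impossible since the blocks go to infinity.
    In the other direction, take the sets of points with large sections. *)
From mathcomp Require Import all_boot finmap.
From mathcomp Require Import boolp.
Require Import Defs.
From mathcomp Require Import classical_sets filter.

Set Implicit Arguments.
Unset Strict Implicit.
Unset Printing Implicit Defensive.

Local Open Scope classical_set_scope.
Local Open Scope fset_scope.
Local Open Scope nat_scope.

(** * Elements and spans of block sequences *)

Lemma FINmin_gtP (x : FIN) (m : nat) :
  reflect (forall a, a \in val x -> m < a) (m < FINmin x).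
Proof.
apply: (iffP idP) => [mx a ax|]; last by apply; exact: FINmin_in.
exact: leq_trans mx (FINmin_le ax).
Qed.

Lemma FIN_of_fset (s : {fset nat}) (a : nat) :
  a \in s -> exists x : FIN, val x = s.
Proof.
move=> as_; have s0 : s != fset0 by apply/fset0Pn; exists a.
by exists (exist _ s s0).
Qed.

Lemma in_block_spanP (X : FINinf) (y : FIN) :
  block_span X y <->
  exists F : FIN, forall a,
    a \in val y <-> exists2 i, i \in val F & a \in val (X i).
Proof.
split=> -[F yF]; exists F; first move=> a.
  rewrite yF; split=> [/bigfcupP[i /andP[iF _] ai]|[i iF ai]].
    by exists i.
  by apply/bigfcupP; exists i => //; rewrite andbT.
apply/fsetP => a; apply/idP/bigfcupP => [/yF[i iF ai]|[i /andP[iF _] ai]].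
  by exists i => //; rewrite andbT.
by apply/yF; exists i.
Qed.

Lemma block_in_span (X : FINinf) (i : nat) : block_span X (X i).
Proof.
apply/in_block_spanP; have [F Fi] := FIN_of_fset (fset11 i).
exists F => a; rewrite Fi; split=> [ai|[j /fset1P->]//].
by exists i => //; exact: fset11.
Qed.

Lemma block_span_union (X : FINinf) (x y z : FIN) :
  block_span X x -> block_span X y -> val z = val x `|` val y ->
  block_span X z.
Proof.
move=> /in_block_spanP[F xF] /in_block_spanP[G yG] zxy.
have FGm : FINmin F \in val F `|` val G by rewrite inE FINmin_in.
have [H HE] := FIN_of_fset FGm.
apply/in_block_spanP; exists H => a; rewrite zxy HE; split.
  rewrite inE => /orP[/xF|/yG] [i iF ai]; exists i => //;
  by rewrite inE iF ?orbT.
move=> [i]; rewrite !inE => /orP[iF|iG] ai; apply/orP; [left|right].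
  by apply/xF; exists i.
by apply/yG; exists i.
Qed.

Lemma block_span_tail_sub (X : FINinf) (m : nat) :
  (block_span (block_tail X m) `<=` block_span X)%classic.
Proof.
move=> y /in_block_spanP[F yF].
set n := ex_minn (ex_min_gt X m) in yF *.
have Fm : n + FINmin F \in [fset n + i | i in val F].
  by apply: in_imfset; exact: FINmin_in.
have [G GE] := FIN_of_fset Fm.
apply/in_block_spanP; exists G => a; rewrite GE; apply: (iff_trans (yF a)).
split=> [[i iF ai]|[_ /imfsetP[i iF ->] ai]]; last by exists i.
by exists (n + i) => //; exact: in_imfset.
Qed.

Lemma block_span_tail (X : FINinf) (m : nat) (y : FIN) :
  block_span X y -> m < FINmin y -> block_span (block_tail X m) y.
Proof.
move=> /in_block_spanP[F yF] my; apply/in_block_spanP.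
rewrite /block_tail /=; case: ex_minnP => n _ n_le.
(* Each block occurring in [y] has minimum above [m], and [n] is the least index of such a block, so
   the indices in [F] can be shifted down by [n]. *)
have nF i : i \in val F -> n <= i.
  move=> iF; apply/n_le/FINmin_gtP => a ai.
  by apply: (FINmin_gtP _ _ my); apply/yF; exists i.
have Fm : FINmin F - n \in [fset i - n | i in val F].
  by apply: in_imfset; exact: FINmin_in.
have [G GE] := FIN_of_fset Fm.
exists G => a; rewrite GE; apply: (iff_trans (yF a)).
split=> [[i iF ai]|[_ /imfsetP[i iF ->]]].
  by exists (i - n); [exact: in_imfset|rewrite subnKC ?nF].
by rewrite subnKC ?nF //; exists i.
Qed.

(** * Counting the large steps of a finite set *)

Definition big_steps (g : nat -> nat) (s : {fset nat}) : {fset nat} :=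
  [fset a in s | [forall b : s, (a < val b) ==> (g a < val b)]].

(** Testing every larger [b] amounts to testing the successor of [a] in [s], the least of them. The
    maximum of [s] passes vacuously. *)
Lemma in_big_stepsP (g : nat -> nat) (s : {fset nat}) (a : nat) :
  a \in big_steps g s <->
  a \in s /\ forall b, b \in s -> a < b -> g a < b.
Proof.
rewrite !inE /=; split=> [/andP[as_ /forallP sa]|[as_ sa]].
  by split=> // b bs; apply/implyP; exact: (sa [` bs]).
apply/andP; split=> //; apply/forallP => b; apply/implyP; exact: sa (valP b).
Qed.

(** In the union only [FINmax x] gets a new successor, namely [FINmin y]. It was counted in [x] for
    having none, and is lost exactly when this new step is small. *)
Lemma card_big_steps_union (g : nat -> nat) (x y : FIN) :
  FINmax x < FINmin y ->
  #|` big_steps g (val x `|` val y)| + (FINmin y <= g (FINmax x)) =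
  #|` big_steps g (val x)| + #|` big_steps g (val y)|.
Proof.
move=> xy.
have ltxy a b : a \in val x -> b \in val y -> a < b.
  move=> /FINmax_ge ax /FINmin_le yb.
  exact: leq_ltn_trans ax (leq_trans xy yb).
have mx : FINmax x \in big_steps g (val x).
  apply/in_big_stepsP; split=> [|b /FINmax_ge bx]; first exact: FINmax_in.
  by rewrite ltnNge bx.
(* [S] is the share of [x] in the count for the union. *)
pose S := if g (FINmax x) < FINmin y then big_steps g (val x)
          else big_steps g (val x) `\ FINmax x.
have SE : #|` S| + (FINmin y <= g (FINmax x)) = #|` big_steps g (val x)|.
  rewrite /S; case: ltnP => _; first by rewrite addn0.
  by rewrite [RHS](cardfsD1 (FINmax x)) mx addnC.
have inS a : a \in S ->
    a \in big_steps g (val x) /\ (a = FINmax x -> g (FINmax x) < FINmin y).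
  rewrite /S; case: ltnP => _; first by [].
  by rewrite !in_fsetD1 => /andP[/eqP ? ?].
have Sin a : a \in big_steps g (val x) ->
    (a = FINmax x -> g (FINmax x) < FINmin y) -> a \in S.
  rewrite /S; case: ltnP => // _ ax am.
  by rewrite in_fsetD1 ax andbT; apply/eqP => /am.
have -> : big_steps g (val x `|` val y) = S `|` big_steps g (val y).
  apply/fsetP => a; apply/idP/idP.
    move=> /in_big_stepsP[]; rewrite !in_fsetU => /orP[ax|ay] asucc.
      apply/orP; left; apply: Sin => [|aE].
        apply/in_big_stepsP; split=> // b bx; apply: asucc.
        by rewrite in_fsetU bx.
      rewrite -aE; apply: asucc; first by rewrite in_fsetU FINmin_in orbT.
      exact: ltxy ax (FINmin_in y).
    apply/orP; right; apply/in_big_stepsP; split=> // b bY; apply: asucc.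
    by rewrite in_fsetU bY orbT.
  rewrite in_fsetU => /orP[/inS[/in_big_stepsP[ax asucc] am]|].
    apply/in_big_stepsP; split=> [|b]; first by rewrite in_fsetU ax.
    rewrite in_fsetU => /orP[/asucc//|bY] _.
    have [aE|] := eqVneq a (FINmax x).
      by rewrite aE; exact: leq_trans (am aE) (FINmin_le bY).
    (* A non-maximal [a] already has [g a] below [FINmax x], hence below all of [y]. *)
    move=> anm; apply: (@ltn_trans (FINmax x)).
      by apply: asucc (FINmax_in x) _; rewrite ltn_neqAle anm FINmax_ge.
    exact: ltxy (FINmax_in x) bY.
  move=> /in_big_stepsP[ay asucc]; apply/in_big_stepsP.
  split=> [|b]; first by rewrite in_fsetU ay orbT.
  rewrite in_fsetU => /orP[bx|/asucc//].
  by move=> /ltnW; rewrite leqNgt ltxy.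
have dis : S `&` big_steps g (val y) = fset0.
  apply/fsetP => a; rewrite in_fsetI in_fset0; apply/negP => /andP[].
  move=> /inS[/in_big_stepsP[ax _] _] /in_big_stepsP[ay _].
  by have := ltxy _ _ ax ay; rewrite ltnn.
by rewrite -SE addnAC -[in RHS]cardfsUI dis cardfs0 addn0.
Qed.

(** Modulo 2 the counting identity reads [p] + error = [p] + [p], so the error term equals [p] for
    every pair. One pair with a large gap then forces [p] to be false. *)
Lemma homogeneous_gaps (g : nat -> nat) (Z : FINinf) (p : bool) :
  (forall z, block_span Z z -> odd #|` big_steps g (val z)| = p) ->
  forall x y, block_span Z x -> block_span Z y -> FINmax x < FINmin y ->
    g (FINmax x) < FINmin y.
Proof.
move=> hom.
have bad x y : block_span Z x -> block_span Z y -> FINmax x < FINmin y ->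
    (FINmin y <= g (FINmax x)) = p.
  move=> Zx Zy xy; have xm : FINmin x \in val x `|` val y.
    by rewrite in_fsetU FINmin_in.
  have [z zE] := FIN_of_fset xm.
  have := congr1 odd (card_big_steps_union g xy).
  rewrite !oddD -zE !hom //; last exact: block_span_union zE.
  by case: p {hom} => /=; case: (_ <= _).
move=> x y Zx Zy xy; rewrite ltnNge bad //.
(* Block [k.+1] starts beyond [FINmax x], so it can follow [x], and beyond [g (FINmax x)], so the
   gap is large. *)
pose k := maxn (FINmax x) (g (FINmax x)).
have kZ : k < FINmin (Z k.+1) := block_min_ge Z k.+1.
rewrite -(bad x (Z k.+1)) //; first last.
- exact: leq_ltn_trans (leq_maxl _ _) kZ.
- exact: block_in_span.
by rewrite -ltnNge; exact: leq_ltn_trans (leq_maxr _ _) kZ.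
Qed.

(** * Tukey maps and the product filter *)

Lemma tukey_le_monotone (P Q : Type) (leP : P -> P -> Prop)
    (leQ : Q -> Q -> Prop) (f : Q -> P) :
  (forall p q r, leP p q -> leP q r -> leP p r) ->
  (forall q r, leQ q r -> leP (f q) (f r)) ->
  (forall p, exists q, leP p (f q)) -> tukey_le leP leQ.
Proof.
move=> tr mono cof; exists f => D cofD p.
have [q pq] := cof p; have [d Dd qd] := cofD q.
by exists (f d); [exists d|exact: tr pq (mono _ _ qd)].
Qed.

Lemma rev_incl_trans (T : Type) (U : set_system T) (A B C : U) :
  rev_incl U A B -> rev_incl U B C -> rev_incl U A C.
Proof. by rewrite /rev_incl => AB BC; exact: subset_trans BC AB. Qed.

Definition member_of (T : Type) (U : set_system T) (A : set T) (UA : U A) : U :=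
  exist _ A (mem_set UA).

Lemma fubini_prod_tukey_ge (X Y : Type) (U : set_system X) (V : set_system Y) :
  Filter U -> ProperFilter V ->
  tukey_le (rev_incl U) (rev_incl (fubini_prod U V)).
Proof.
move=> fU fV.
pose f (A : fubini_prod U V) : U :=
  member_of (set_mem (valP A) : U [set x | V [set y | val A (x, y)]]).
apply: (@tukey_le_monotone _ _ _ _ f) => [|A B AB x /=|B].
- exact: rev_incl_trans.
- by apply: filterS => y; exact: AB.
(* Cofinality is witnessed by the cylinder over [B]: a section in the proper filter [V] is nonempty,
   which puts its base point in [B]. *)
have UVB : fubini_prod U V [set z | val B z.1].
  rewrite /fubini_prod /=; apply: filterS (set_mem (valP B)) => x Bx.
  exact: filterS filterT.
exists (member_of UVB) => x /= /filter_ex[y]; exact.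
Qed.

(** * Diagonalization and homogeneous spans *)

Lemma milliken_taylor_min_gt (U : set_system FIN) (m : nat) :
  milliken_taylor U -> U [set y : FIN | m < FINmin y].
Proof.
move=> [UF span_base _].
(* Otherwise the complement contains a span, although block [m.+1] of any sequence has minimum above
   [m]. *)
have [//|/span_base[X [XS _]]] :=
  in_ultra_setVsetC [set y : FIN | m < FINmin y] UF.
have /XS /= := block_in_span X m.+1.
by case; exact: block_min_ge.
Qed.

Lemma FIN_bounded_bigcap (U : set_system FIN) (A : FIN -> set FIN) (n : nat) :
  Filter U -> (forall x, FINmax x <= n -> U (A x)) ->
  U [set y | forall x, FINmax x <= n -> A x y].
Proof.
move=> fU UA.
pose D : {fset {fset nat}} := fpowerset [fset i in iota 0 n.+1].
(* The intersection is finite, being indexed by the subsets of {0, ..., [n]}; the empty subset,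
   which is no element of [FIN], imposes no condition. *)
pose f (s : {fset nat}) : set FIN :=
  [set y | forall x : FIN, val x = s -> FINmax x <= n -> A x y].
have /(filter_bigI (D := D)) : forall s, s \in D -> U (f s).
  move=> s _.
  have [[x xs xn]|nex] := pselect (exists2 x : FIN, val x = s & FINmax x <= n).
    apply: filterS (UA x xn) => y Axy x' x's _.
    by rewrite (_ : x' = x) //; apply: val_inj; rewrite xs.
  by apply: filterS filterT => y _ x xs xn; case: nex; exists x.
apply: filterS => y Dy x xn; apply: (Dy (val x)) => //=.
rewrite fpowersetE; apply/fsubsetP => a /FINmax_ge ax.
have an : a \in iota 0 n.+1 by rewrite mem_iota ltnS (leq_trans ax).
by apply/imfsetP; exists a.
Qed.

(** Stability is applied to a decreasing sequence of spans inside the [B n]; [g n] is the cut after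
    which the span of [Y] lies in the [n]-th one. *)
Lemma milliken_taylor_diagonal (U : set_system FIN) (B : nat -> set FIN) :
  milliken_taylor U -> (forall n, U (B n)) ->
  exists (Y : FINinf) (g : nat -> nat), U (block_span Y) /\
    forall n y, block_span Y y -> g n < FINmin y -> B n y.
Proof.
move=> [UF span_base stable] UB.
(* [X0] is only a default value of the choice function [h] outside [U]. *)
have [X0 _] := span_base _ filterT.
have /choice[h hP] : forall A : set FIN, exists X : FINinf,
    U A -> (block_span X `<=` A)%classic /\ U (block_span X).
  move=> A; have [/span_base[X XA]|nUA] := pselect (U A).
    by exists X.
  by exists X0.
(* Intersecting with the previous span makes the spans decrease, so the cut 0 witnesses
   [almost_le]. *)
pose X := fix X n :=
  if n is n'.+1 then h (B n `&` block_span (X n'))%classic else h (B 0).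
have UX n : U (block_span (X n)).
  elim: n => [|n IHn] /=; first by have [] := hP _ (UB 0).
  by have [] := hP _ (filterI (UB n.+1) IHn).
have XB n : (block_span (X n) `<=` B n)%classic.
  case: n => [|n] /=; first by have [] := hP _ (UB 0).
  by have [+ _] := hP _ (filterI (UB n.+1) (UX n)); rewrite subsetI => -[].
have XS n : almost_le (X n.+1) (X n).
  exists 0; apply: (subset_trans (@block_span_tail_sub _ 0)) => /=.
  by have [+ _] := hP _ (filterI (UB n.+1) (UX n)); rewrite subsetI => -[].
have [Y [UY /choice[g gP]]] := stable X XS UX.
exists Y, g; split=> // n y Yy gy.
exact/XB/gP/block_span_tail.
Qed.

Lemma milliken_taylor_ramsey (U : set_system FIN) (A : set (FIN * FIN)) :
  milliken_taylor U -> fubini_prod U U A ->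
  exists2 Z : FINinf, U (block_span Z) &
    forall x y, block_span Z x -> block_span Z y -> FINmax x < FINmin y ->
      A (x, y).
Proof.
move=> mtU UUA; have [UF span_base _] := mtU.
pose A1 : set FIN := [set x | U [set y | A (x, y)]].
(* Treating all [x] with maximum at most [n] at once makes the required gap depend on [FINmax x]
   alone. *)
pose B n : set FIN :=
  [set y | forall x, FINmax x <= n -> A1 x -> A (x, y)].
have UB n : U (B n).
  apply: (@FIN_bounded_bigcap U (fun x => [set y | A1 x -> A (x, y)])) => x _.
  have [A1x|nA1x] := pselect (A1 x); first by apply: filterS A1x => y Axy.
  by apply: filterS filterT => y _ /nA1x.
have [Y [g [UY YB]]] := milliken_taylor_diagonal mtU UB.
pose C : set FIN := [set z | odd #|` big_steps g (val z)|].
have [p UC] : exists p, U [set z : FIN | odd #|` big_steps g (val z)| = p].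
  have [UC|UC] := in_ultra_setVsetC C UF; first by exists true.
  by exists false; apply: filterS UC => z /negP/negbTE.
(* One span meets all three demands: large sections, membership in the span of [Y], and constant
   parity. *)
have [Z [ZS UZ]] := span_base _ (filterI (filterI (UUA : U A1) UY) UC).
exists Z => // x y Zx Zy xy.
have gap : g (FINmax x) < FINmin y.
  by apply: (homogeneous_gaps (Z := Z) (p := p)) xy => // z /ZS[_]; exact.
have [[A1x _] _] := ZS _ Zx; have [[_ Yy] _] := ZS _ Zy.
exact: YB Yy gap x (leqnn _) A1x.
Qed.

Lemma milliken_taylor_tukey_le (U : set_system FIN) :
  milliken_taylor U -> tukey_le (rev_incl (fubini_prod U U)) (rev_incl U).
Proof.
move=> mtU; have [UF _ _] := mtU.
pose sq (B : set FIN) : set (FIN * FIN) :=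
  [set z | [/\ B z.1, B z.2 & FINmax z.1 < FINmin z.2]].
(* For [x] in [B] the section consists of the [y] in [B] that start after [x], an intersection of
   two members of [U]. *)
have UUsq (B : U) : fubini_prod U U (sq (val B)).
  have UB := set_mem (valP B).
  rewrite /fubini_prod /=; apply: filterS (UB) => x Bx.
  by apply: filterS2 UB (milliken_taylor_min_gt (FINmax x) mtU) => y.
apply: (@tukey_le_monotone _ _ _ _ (fun B => member_of (UUsq B)))
  => [|B C CB [x y] /=|A].
- exact: rev_incl_trans.
- by case=> /= /CB Bx /CB By xy.
have [Z UZ ZA] := milliken_taylor_ramsey mtU (set_mem (valP A)).
by exists (member_of UZ) => -[x y] /= []; exact: ZA.
Qed.

Theorem theorem4p7 (U : set_system FIN) (hU : milliken_taylor U) :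
  tukey_equiv (rev_incl (fubini_prod U U)) (rev_incl U).
Proof.
have [UF _ _] := hU; split; first exact: milliken_taylor_tukey_le.
exact: fubini_prod_tukey_ge.
Qed.
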